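(* The $C(\lambda)$-typical function satisfies the periodic specification property; that is, there is a dense $G_\delta$ subset $G$ of the metric space $(C(\lambda),\rho)$ such that every $f\in G$ has the periodic specification property.
   Context: $\lambda$ is the Lebesgue measure on $[0,1]$, $\mathcal B$ the Borel $\sigma$-algebra of $[0,1]$. $C(\lambda)$ is the set of all continuous maps $f\colon[0,1]\to[0,1]$ with $\lambda(A)=\lambda(f^{-1}(A))$ for all $A\in\mathcal B$, equipped with the complete metric $\rho(f,g)=\sup_{x\in[0,1]}|f(x)-g(x)|$. For integers $b\ge a\ge 0$ let $f^{[a,b]}(x):=\{f^j(x): a\le j\le b\}$. A family of orbit segments $\{f^{[a_j,b_j]}(x_j)\}_{j=1}^n$ (with $x_j\in[0,1]$) is an $N$-spaced specification if $a_i-b_{i-1}\ge N$ for $2\le i\le n$. A specification $\{f^{[a_j,b_j]}(x_j)\}_{j=1}^n$ is $\varepsilon$-shadowed by $y\in[0,1]$ if $|f^k(y)-f^k(x_i)|\le\varepsilon$ for all $a_i\le k\le b_i$ and $1\le i\le n$. The map $f$ has the specification property if for any $\varepsilon>0$ there is a constant $N=N(\varepsilon)$ (a positive integer) such that any $N$-spaced specification $\{f^{[a_j,b_j]}(x_j)\}_{j=1}^n$ is $\varepsilon$-shadowed by some $y\in[0,1]$. If additionally $y$ can be chosen in such a way that $f^{b_n-a_1+N}(y)=y$, then $f$ has the periodic specification property. *)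

(* Defs.v *)
From HB Require Import structures.
From mathcomp Require Import all_boot all_order all_algebra.
From mathcomp Require Import all_classical all_reals all_analysis.

Set Implicit Arguments.
Unset Strict Implicit.
Unset Printing Implicit Defensive.

Import Order.TTheory GRing.Theory Num.Theory.
Import numFieldNormedType.Exports.

Local Open Scope classical_set_scope.
Local Open Scope ring_scope.

(* The subtype {x : R | x \in `[0, 1]}, with the library's subtype topology. *)
Definition unit_itv (R : realType) : Type :=
  set_type (`[0%R, 1%R]%classic : set R).

Definition unit_val (R : realType) (x : unit_itv R) : R := set_val x.

Definition unit_lebesgue (R : realType) (A : set (unit_itv R)) : \bar R :=
  lebesgue_measure (@unit_val R @` A).

Definition unit_borel (R : realType) : set (set (unit_itv R)) :=
  <<s @open (unit_itv R) >>.

Record Clambda (R : realType) : Type := MkClambda {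
  Clambda_fun :> unit_itv R -> unit_itv R;
  Clambda_continuous : continuous Clambda_fun;
  Clambda_preserving : forall A : set (unit_itv R), unit_borel A ->
    unit_lebesgue A = unit_lebesgue (Clambda_fun @^-1` A)
}.

HB.instance Definition _ (R : realType) := gen_eqMixin (Clambda R).
HB.instance Definition _ (R : realType) := gen_choiceMixin (Clambda R).

Definition rho (R : realType) (f g : Clambda R) : R :=
  sup (range (fun x : unit_itv R => `|unit_val (f x) - unit_val (g x)|)).

Section rho_metric.
Context {R : realType}.
Implicit Types f g h : Clambda R.

Let unit_val_ge0 (x : unit_itv R) : 0 <= unit_val x.
Proof. by have := set_valP x; rewrite /= in_itv /= => /andP[]. Qed.

Let unit_val_le1 (x : unit_itv R) : unit_val x <= 1.
Proof. by have := set_valP x; rewrite /= in_itv /= => /andP[]. Qed.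

Let zero : unit_itv R.
Proof. by exists 0; rewrite inE /= in_itv /= lexx ler01. Defined.

Let rho_ub f g x : `|unit_val (f x) - unit_val (g x)| <= rho f g.
Proof.
apply: ub_le_sup; last by exists x.
exists 1 => _ [y _ <-]; rewrite ler_norml.
have := unit_val_ge0 (f y); have := unit_val_ge0 (g y).
have := unit_val_le1 (f y); have := unit_val_le1 (g y).
move=> g1 f1 g0 f0; apply/andP; split.
  by rewrite lerBrDl (le_trans _ f0)// subr_le0.
by rewrite lerBlDr (le_trans f1)// lerDl.
Qed.

Let rho_le f g c :
  (forall x, `|unit_val (f x) - unit_val (g x)| <= c) -> rho f g <= c.
Proof.
move=> fgc; apply: ge_sup => [|_ [x _ <-]]; last exact: fgc.
by exists `|unit_val (f zero) - unit_val (g zero)|, zero.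
Qed.

Lemma rhoxx f : rho f f = 0.
Proof.
apply/eqP; rewrite eq_le; apply/andP; split.
  by apply: rho_le => x; rewrite subrr normr0.
by apply: le_trans (rho_ub f f zero); exact: normr_ge0.
Qed.

Lemma rho_positivity f g : rho f g = 0 -> f = g.
Proof.
move=> fg0; have fgE : (f : unit_itv R -> unit_itv R) = g.
  apply/funext => x; apply: val_inj; apply/eqP.
  rewrite -subr_eq0 -normr_le0; apply: le_trans (rho_ub f g x) _.
  by rewrite fg0.
case: f g fgE {fg0} => [f fc fp] [g gc gp] /= fgE.
by subst g; congr MkClambda; exact: Prop_irrelevance.
Qed.

Lemma rho_sym f g : rho f g = rho g f.
Proof. by rewrite /rho; under eq_fun do rewrite distrC. Qed.

Lemma rho_triangle g f h : rho f h <= rho f g + rho g h.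
Proof.
apply: rho_le => x; rewrite (le_trans (ler_distD (unit_val (g x)) _ _))//.
by apply: lerD; exact: rho_ub.
Qed.

End rho_metric.

HB.instance Definition _ (R : realType) :=
  @isMetric.Build R (Clambda R) (@rho R) rhoxx rho_positivity rho_sym
    rho_triangle.

(* The segments f^[a_j, b_j](x_j) are indexed by j : 'I_n.+1, so that a
   specification consists of at least one segment and its first and last
   segments are those of index ord0 and ord_max. *)
Definition spaced_specification (N n : nat) (a b : 'I_n.+1 -> nat) : Prop :=
  (forall j, (a j <= b j)%N) /\
  (forall i j : 'I_n.+1, (j = i.+1 :> nat) -> (b i + N <= a j)%N).

(* Times are absolute: at time k the orbit of y is compared with f^k(x_i). *)
Definition shadows (R : realType) (f : unit_itv R -> unit_itv R) (eps : R)
    (n : nat) (a b : 'I_n.+1 -> nat) (x : 'I_n.+1 -> unit_itv R)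
    (y : unit_itv R) : Prop :=
  forall (i : 'I_n.+1) (k : nat), (a i <= k <= b i)%N ->
    `|unit_val (iter k f y) - unit_val (iter k f (x i))| <= eps.

Definition periodic_specification_property (R : realType)
    (f : unit_itv R -> unit_itv R) : Prop :=
  forall eps : R, 0 < eps ->
  exists2 N : nat, (0 < N)%N &
    forall (n : nat) (a b : 'I_n.+1 -> nat) (x : 'I_n.+1 -> unit_itv R),
    spaced_specification N a b ->
    exists2 y : unit_itv R, shadows f eps a b x y &
      iter (b ord_max - a ord0 + N)%N f y = y.

(* Main.v *)
Require Import Defs.
From HB Require Import structures.
From mathcomp Require Import all_boot all_order all_algebra.
From mathcomp Require Import all_classical all_reals all_analysis borel_hierarchy.
From mathcomp Require Import measurable_realfun lra zify.

Set Implicit Arguments.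
Unset Strict Implicit.
Unset Printing Implicit Defensive.

Import Order.TTheory GRing.Theory Num.Theory.
Import numFieldNormedType.Exports.

Local Open Scope classical_set_scope.
Local Open Scope ring_scope.

(** A map [f] in C(lambda) does not shrink intervals: an interval J is contained
    in the preimage of f(J), which has the measure of f(J) ([nonshrinking]). This
    makes the periodic specification property a consequence of the covering
    property: for every e there is an N such that f^n maps every interval of
    length at least e onto [0, 1] for all n >= N ([covers]). Indeed, let J be the
    interval obtained from a point x by stopping as soon as f^m has moved by e.
    Its m-th image has length at least e, and, lengths being nondecreasing along
    the orbit, the first m images of J have diameter at most 2e
    ([shadowing_interval]). So J shadows the segment of x, its image at the end of
    the segment covers everything after N more steps, and the intervals attached to
    successive segments can be chained ([nested_covering]). Closing the chain with
    [0, 1] gives a periodic point by the intermediate value theorem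
    ([covers_specification]).

    The set G is the intersection over k of the sets [escaping] and [spreading k].
    The second one asks that some iterate stretches each of the intervals
    [i/(k+1), (i+1)/(k+1)] to a length larger than 1 - 1/(k+1). Being onto is not
    an open condition, but this one is, and it is enough: for an escaping map,
    that is when 0 and 1 are sent to interior points, the preimages of 0 and 1 stay
    away from the ends, so an interval which is almost everything is mapped onto
    [0, 1] one step later ([generic_covers]).

    For the density, let [f] be in C(lambda) and replace it by E o h o f, where E
    and h belong to C(lambda) and are close to the identity. The map h is chosen
    to stretch every interval which is neither too short nor too long by a fixed
    amount ([expander]). Since [f] and E do not shrink intervals, iterating
    E o h o f makes any nondegenerate interval grow up to almost the full length, whatever [f]
    is ([spread_iter]). The map h is a composition of threefold zigzags on small
    windows whose interiors cover the interior of [0, 1]: a zigzag moves outwards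
    the ends of an interval that lie in its window ([zig_dichotomy]). The map E
    folds small neighbourhoods of 0 and 1, which makes the composition escaping for
    all but finitely many sizes of the folds ([folded_ends]). The measure
    is preserved by each of these piecewise affine maps because their sublevel sets
    have the right length ([preserving_of_cdf]). *)

(** * Maps of the unit interval seen on the real line *)

Section unit_interval.
Context {R : realType}.
Implicit Types (x : unit_itv R) (r : R) (f g : Clambda R).

Lemma unit_valP x : 0 <= unit_val x <= 1.
Proof. by have := set_valP x; rewrite /= in_itv. Qed.

Definition clamp r : R := Num.max 0 (Num.min r 1).

Lemma clamp_id r : 0 <= r <= 1 -> clamp r = r.
Proof. by move=> /andP[r0 r1]; rewrite /clamp min_l// max_r. Qed.

Lemma clamp_unit r : clamp r \in (`[0%R, 1%R]%classic : set R).
Proof.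
by rewrite inE /= in_itv /= le_max lexx ge_max ler01 ge_min lexx orbT.
Qed.

Definition to_unit r : unit_itv R := exist _ (clamp r) (clamp_unit r).

Lemma to_unitK r : 0 <= r <= 1 -> unit_val (to_unit r) = r.
Proof. exact: clamp_id. Qed.

Lemma unit_val_inj : injective (@unit_val R).
Proof. exact: val_inj. Qed.

Lemma unit_valK x : to_unit (unit_val x) = x.
Proof. by apply: unit_val_inj; rewrite to_unitK// unit_valP. Qed.

Lemma continuous_unit_val : continuous (@unit_val R).
Proof. exact: initial_continuous. Qed.

Lemma continuous_clamp : continuous clamp.
Proof.
apply: max_fun_continuous; first by move=> ?; exact: cvg_cst.
by apply: min_fun_continuous => ?; [exact: cvg_id|exact: cvg_cst].
Qed.

Lemma continuous_to_unit : continuous to_unit.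
Proof. exact/continuous_comp_initial/continuous_clamp. Qed.

(** Extending a self-map of the unit interval by clamping the argument gives a
    continuous self-map of the whole line, to which the intermediate and extreme
    value theorems apply without any side condition on the domain. *)
Definition real_ext (f : unit_itv R -> unit_itv R) r := unit_val (f (to_unit r)).

Lemma real_ext01 f r : 0 <= real_ext f r <= 1. Proof. exact: unit_valP. Qed.

Lemma continuous_real_ext f : continuous (real_ext f).
Proof.
move=> r; apply: (@continuous_comp _ _ _ (f \o to_unit) (@unit_val R)).
  by apply: continuous_comp; [exact: continuous_to_unit|exact: Clambda_continuous].
exact: continuous_unit_val.
Qed.

Definition unit_map (H : R -> R) x := to_unit (H (unit_val x)).

Lemma continuous_unit_map (H : R -> R) : continuous H -> continuous (unit_map H).
Proof.
move=> cH x; apply: (@continuous_comp _ _ _ (H \o @unit_val R) to_unit);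
  last exact: continuous_to_unit.
by apply: continuous_comp; [exact: continuous_unit_val|exact: cH].
Qed.

Lemma image_unit_val (B : set R) :
  @unit_val R @` (@unit_val R @^-1` B) = `[0, 1] `&` B.
Proof.
apply/seteqP; split => [_ [x Bx <-]|r []].
  by split=> //=; rewrite in_itv /= unit_valP.
rewrite /= in_itv /= => r01 Br; exists (to_unit r); rewrite /= to_unitK//.
Qed.

Lemma unit_borel_measurable (A : set (unit_itv R)) : unit_borel A ->
  exists2 B : set R, measurable B & A = @unit_val R @^-1` B.
Proof.
move: A; apply: smallest_sub.
  split.
  - by exists set0; rewrite ?preimage_set0.
  - move=> _ [B mB ->]; exists (~` B); first exact: measurableC.
    by rewrite setTD preimage_setC.
  - move=> F FB; have /choice[B BP] n : exists X, measurable X /\ F n = @unit_val R @^-1` X.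
      by have [X mX FX] := FB n; exists X.
    exists (\bigcup_n B n); first by apply: bigcupT_measurable => n; have [] := BP n.
    by rewrite preimage_bigcup; apply: eq_bigcupr => n _; have [] := BP n.
move=> A [B oB <-]; exists B => //; exact: open_measurable.
Qed.

Lemma continuous_unit_borel (h : unit_itv R -> unit_itv R) A :
  continuous h -> unit_borel A -> unit_borel (h @^-1` A).
Proof.
move=> ch; move: A; apply: smallest_sub.
  split.
  - by rewrite preimage_set0; apply: sigma_algebra0; exact: smallest_sigma_algebra.
  - move=> B hB; rewrite setTD preimage_setC -setTD.
    exact: sigma_algebraCD hB.
  - move=> F hF; rewrite preimage_bigcup; exact: sigma_algebra_bigcup.
move=> B oB; apply: sub_sigma_algebra; exact: open_comp.
Qed.

Lemma closed_interval_borel (s t : R) : unit_borel (@unit_val R @^-1` `[s, t]).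
Proof.
rewrite -[X in unit_borel X]setCK -setTD; apply: sigma_algebraCD.
apply: sub_sigma_algebra; rewrite preimage_setC.
apply: open_comp; first by move=> x _; exact: continuous_unit_val.
by rewrite openC; exact: interval_closed.
Qed.

Local Notation mu := (@lebesgue_measure R).

Lemma mu_itvoo (a b : R) : a <= b -> mu `]a, b[%classic = (b - a)%:E.
Proof.
by rewrite lebesgue_measure_itv /= lte_fin -EFinB => ab; case: ltP => // ba; congr EFin; lra.
Qed.

Lemma mu_itvco (a b : R) : a <= b -> mu `[a, b[%classic = (b - a)%:E.
Proof.
by rewrite lebesgue_measure_itv /= lte_fin -EFinB => ab; case: ltP => // ba; congr EFin; lra.
Qed.

(** Two finite Borel measures on the line that agree on the open rays
    bounded above are equal: applied to the restriction of the Lebesgue measure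
    to [0, 1] and to its image by [H]. *)
Lemma preserving_of_cdf (H : R -> R) : continuous H ->
  (forall r, 0 <= r <= 1 -> 0 <= H r <= 1) ->
  (forall t, 0 < t <= 1 -> mu (`[0, 1] `&` [set r | H r < t]) = t%:E) ->
  forall A : set (unit_itv R), unit_borel A ->
    unit_lebesgue A = unit_lebesgue (unit_map H @^-1` A).
Proof.
move=> cH H01 Ht A /unit_borel_measurable[B mB ->].
have mH : measurable_fun setT H by exact: continuous_measurable_fun.
have m01 : measurable (`[0, 1]%classic : set R) by [].
rewrite /unit_lebesgue.
have -> : unit_map H @^-1` (@unit_val R @^-1` B) = @unit_val R @^-1` (H @^-1` B).
  apply/seteqP; split => x; rewrite /= /unit_map to_unitK//; exact/H01/unit_valP.
rewrite !image_unit_val.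
pose m1 : {measure set (measurableTypeR R) -> \bar R} := mrestr mu m01.
suff : m1 B = pushforward m1 (H : R -> measurableTypeR R)
  B by rewrite /m1 /pushforward /= /mrestr !(setIC _ `[0, 1]%classic).
have m1oo (X : set R) : measurable X -> (m1 X < +oo)%E.
  move=> mX; rewrite /m1 /= /mrestr (@le_lt_trans _ _ (mu `[0, 1]%classic))//.
    by apply: le_measure; rewrite ?inE//; exact: measurableI.
  by rewrite lebesgue_measure_itv /= lte_fin ltr01 -EFinB ltry.
apply: (@measure_unique _ _ (measurableTypeR R) (@RGenInftyO.G R)
  (fun n => `]-oo, n%:R[%classic) _ _ _ _ m1 _ _ _ B mB) => //.
- exact: RGenInftyO.measurableE.
- move=> _ _ [a ->] [b ->]; exists (Num.min a b).
  by apply/seteqP; split=> r; rewrite /= !in_itv /= lt_min; [case=> -> ->|move/andP].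
- by move=> n; exists n%:R.
- apply/seteqP; split=> r //= _; exists (Num.truncn r).+1 => //=.
  rewrite in_itv /=; have [r0|r0] := leP 0 r; first by have /andP[] := truncn_itv r0.
  exact: (lt_le_trans r0).
- move=> _ [t ->]; rewrite /= /pushforward /m1 /= /mrestr !(setIC _ `[0, 1]%classic).
  have -> : H @^-1` `]-oo, t[ = [set r | H r < t].
    by apply/seteqP; split=> r; rewrite /= in_itv.
  have [t0|t0] := leP t 0.
    transitivity (mu set0); last symmetry; congr (mu _);
      apply/seteqP; split=> r //=; rewrite !in_itv /= => -[].
    + lra.
    + by move=> /H01; lra.
  have [t1|t1] := leP t 1.
    rewrite Ht ?t0// (_ : _ `&` _ = `[0, t[%classic).
      by rewrite lebesgue_measure_itv /= lte_fin t0 -EFinB subr0.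
    by apply/seteqP; split=> r //=; rewrite !in_itv /=; [case|]; lra.
  rewrite !setIidl// => r /=; rewrite !in_itv /=; first by move=> /H01; lra.
  lra.
- by move=> k; apply: m1oo.
Qed.

Lemma Clambda_of_cdf (H : R -> R) : continuous H ->
  (forall r, 0 <= r <= 1 -> 0 <= H r <= 1) ->
  (forall t, 0 < t <= 1 -> mu (`[0, 1] `&` [set r | H r < t]) = t%:E) ->
  exists g, forall r, 0 <= r <= 1 -> real_ext g r = H r.
Proof.
move=> cH H01 Ht; exists (MkClambda (continuous_unit_map cH) (preserving_of_cdf cH H01 Ht)).
by move=> r r01; rewrite /real_ext /= /unit_map !to_unitK//; exact: H01.
Qed.

End unit_interval.

(** * Images of intervals under maps preserving the Lebesgue measure *)

Section dynamics.
Context {R : realType}.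
Implicit Types (r s t x y : R) (f g : Clambda R) (F : R -> R).

Lemma intermediate_value F s t x y v : continuous F -> s <= x <= t -> s <= y <= t ->
  F x <= v <= F y -> exists2 z, s <= z <= t & F z = v.
Proof.
move=> cF sx sy vF.
have [xy|yx] := leP x y.
  have [|z] := @IVT R F x y v xy (continuous_subspaceT cF).
    by rewrite ge_min le_max; lra.
  by rewrite in_itv /= => xz <-; exists z => //; lra.
have [|z] := @IVT R F y x v (ltW yx) (continuous_subspaceT cF).
  by rewrite ge_min le_max; lra.
by rewrite in_itv /= => xz <-; exists z => //; lra.
Qed.

Definition spread F s t l :=
  exists x y, [/\ s <= x <= t, s <= y <= t & l <= F y - F x].

Lemma spread_le F s t l l' : l' <= l -> spread F s t l -> spread F s t l'.
Proof. by move=> ll [x [y [sx sy lxy]]]; exists x, y; split=> //; exact: le_trans lxy. Qed.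

Lemma spread_comp F G s t p q x y l : continuous F ->
  s <= x <= t -> s <= y <= t -> F x <= p -> q <= F y -> spread G p q l ->
  spread (G \o F) s t l.
Proof.
move=> cF sx sy Fx Fy [u [v [pu pv luv]]].
have [|u' su' Fu] := @intermediate_value F s t x y u cF sx sy; first by lra.
have [|v' sv' Fv] := @intermediate_value F s t x y v cF sx sy; first by lra.
by exists u', v'; split=> //=; rewrite Fu Fv.
Qed.

(** The point is the supremum of the set where [F] is at most [v]. *)
Lemma last_passage F x y v : continuous F -> x <= y -> F x <= v <= F y ->
  exists2 z, x <= z <= y & F z = v /\ forall w, z <= w <= y -> v <= F w.
Proof.
move=> cF xy vF.
pose S := [set z | x <= z <= y /\ F z <= v].
have Sx : S x by split; lra.
have hS : has_sup S by split; [exists x|exists y => z []; lra].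
pose z := sup S.
have xz : x <= z by apply: ub_le_sup => //; case: hS.
have zy : z <= y by apply: ge_sup; [exists x|move=> w []; lra].
have above w : z < w <= y -> v < F w.
  move=> /andP[zw wy]; rewrite ltNge; apply/negP => Fw.
  suff : w <= z by lra.
  by apply: ub_le_sup; [case: hS|split=> //; lra].
have Fz : F z <= v.
  rewrite leNgt; apply/negP => vFz.
  have /nbhs_ballP[e /= e0 He] : \forall w \near z, v < F w.
    exact: (cvgr_gt (F z) (cF z)).
  have [w [/= xw Fw]] := sup_adherent e0 hS; rewrite -/z => ezw.
  have wz : w <= z by apply: ub_le_sup; [case: hS|split].
  have : v < F w by apply: He; rewrite /ball /= ger0_norm; lra.
  lra.
have [|||w zw Fw] := @intermediate_value F z y z y v cF; try lra.
have wz : w = z.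
  by apply/eqP; rewrite eq_le [z <= w](andP zw).1 andbT leNgt; apply/negP => /= zlw;
    have := above w; lra.
exists z; first lra.
split; first by rewrite -wz.
move=> u zu; have [->|uz] := eqVneq u z; first by rewrite -wz; lra.
by apply/ltW/above; lra.
Qed.

(** Take the last passage at [c] before [y], then the first passage at [d] after
    it: in between, the values stay in [c, d]. The case where [d] is reached first
    is reduced to this one by the reflection of the line. *)
Lemma subinterval_onto F s t x y c d : continuous F ->
  s <= x <= t -> s <= y <= t -> c <= d -> F x = c -> F y = d ->
  exists s' t', [/\ s <= s', s' <= t', t' <= t,
    (forall z, s' <= z <= t' -> c <= F z <= d) &
    (forall v, c <= v <= d -> exists2 z, s' <= z <= t' & F z = v)].
Proof.
wlog xy : F s t x y / x <= y => [hw|] cF sx sy cd Fx Fy.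
  have [xy|yx] := leP x y; first exact: (hw F s t x y).
  have cG : continuous (F \o -%R).
    by move=> r; apply: continuous_comp; [exact: oppr_continuous|exact: cF].
  have [||||||s' [t' [ss st tt h1 h2]]] := @hw (F \o -%R) (- t) (- s) (- x) (- y) _ cG;
    rewrite /= ?opprK//; try lra.
  exists (- t'), (- s'); split; try lra.
    by move=> z hz; rewrite -[z]opprK; apply: h1; lra.
  by move=> v /h2[z hz <-]; exists (- z) => //; lra.
have [|z xz [Fz zF]] := @last_passage F x y c cF xy; first lra.
have cG : continuous (fun r => - F (- r)).
  move=> r; apply: (@continuous_comp _ _ _ (F \o -%R) -%R); last exact: oppr_continuous.
  by apply: continuous_comp; [exact: oppr_continuous|exact: cF].
have [||w zw [Fw wF]] := @last_passage (fun r => - F (- r)) (- y) (- z) (- d) cG.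
- lra.
- by rewrite !opprK; lra.
have {}wF u : z <= u <= - w -> c <= F u <= d.
  move=> hu; rewrite zF; last lra.
  by have := wF (- u); rewrite opprK; lra.
exists z, (- w); split => //; try lra.
move=> v hv; apply: (@intermediate_value F z (- w) z (- w)) => //; lra.
Qed.

(** The key fact about measure-preserving maps: [s, t] lies in the preimage of its
    own image [m, M], and this preimage has measure M - m, so t - s <= M - m. *)
Lemma nonshrinking f s t : 0 <= s -> s <= t -> t <= 1 -> spread (real_ext f) s t (t - s).
Proof.
move=> s0 st t1.
have cf := @continuous_real_ext R f.
have [y sy ymax] := @EVT_max R (real_ext f) s t st (continuous_subspaceT cf).
have [x sx xmin] := @EVT_min R (real_ext f) s t st (continuous_subspaceT cf).
rewrite !in_itv /= in sx sy; exists x, y; split=> //.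
have := @Clambda_preserving R f _ (closed_interval_borel (real_ext f x) (real_ext f y)).
rewrite /unit_lebesgue image_unit_val setIidr; last first.
  by move=> r /=; rewrite !in_itv /=; have := real_ext01 f x; have := real_ext01 f y; lra.
have xy : real_ext f x <= real_ext f y by apply: xmin; rewrite in_itv.
move=> e; have : (lebesgue_measure `[s, t]%classic <= lebesgue_measure `[real_ext f x,
  real_ext f y]%classic)%E.
  rewrite e; apply: le_measure.
  - by rewrite inE.
  - rewrite inE.
    have [B mB ->] : exists2 B : set R, measurable B &
      f @^-1` (@unit_val R @^-1` `[real_ext f x, real_ext f y]) = @unit_val R @^-1` B.
      apply: unit_borel_measurable; apply: continuous_unit_borel; first exact: Clambda_continuous.
      exact: closed_interval_borel.
    by rewrite image_unit_val; exact: measurableI.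
  - move=> r /=; rewrite in_itv /= => sr; exists (to_unit r); last by rewrite to_unitK//; lra.
    by rewrite /= in_itv /= -/(real_ext f r) ymax ?xmin ?in_itv.
rewrite !lebesgue_measure_itv /= !lte_fin.
case: ltP => [st'|ts]; case: ltP => [xy'|yx'].
- by rewrite -!EFinB lee_fin.
- by rewrite -EFinB lee_fin; lra.
- lra.
- lra.
Qed.

Lemma preserving_Clambda_comp f g (A : set (unit_itv R)) : unit_borel A ->
  unit_lebesgue A = unit_lebesgue ((f \o g) @^-1` A).
Proof.
move=> bA; rewrite (Clambda_preserving f)// (Clambda_preserving g)//.
apply: continuous_unit_borel => //; exact: Clambda_continuous.
Qed.

Lemma continuous_Clambda_comp f g : continuous (f \o g).
Proof.
by move=> x; apply: continuous_comp; exact: Clambda_continuous.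
Qed.

Definition Clambda_comp f g : Clambda R :=
  MkClambda (@continuous_Clambda_comp f g) (@preserving_Clambda_comp f g).

Lemma continuous_Clambda_id : continuous (@id (unit_itv R)).
Proof. by move=> x; exact: cvg_id. Qed.

Definition Clambda_id : Clambda R := MkClambda continuous_Clambda_id (fun A _ => erefl).

Definition Clambda_iter n f := iter n (Clambda_comp f) Clambda_id.

Lemma Clambda_iterE n f (x : unit_itv R) : Clambda_iter n f x = iter n f x.
Proof. by elim: n => //= n <-. Qed.

Lemma real_ext_comp f g r : real_ext (Clambda_comp f g) r = real_ext f (real_ext g r).
Proof. by rewrite /real_ext /= unit_valK. Qed.

Lemma Clambda_iterD m n f (x : unit_itv R) : Clambda_iter (m + n)
  f x = Clambda_iter m f (Clambda_iter n f x).
Proof. by rewrite !Clambda_iterE iterD. Qed.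

Lemma real_ext_iterD m n f r : real_ext (Clambda_iter (m + n) f)
  r = real_ext (Clambda_iter m f) (real_ext (Clambda_iter n f) r).
Proof. by rewrite /real_ext unit_valK Clambda_iterD. Qed.

Lemma real_ext_iterS n f r : real_ext (Clambda_iter n.+1 f)
  r = real_ext f (real_ext (Clambda_iter n f) r).
Proof. exact: real_ext_comp. Qed.

Lemma real_extE f (x : unit_itv R) : real_ext f (unit_val x) = unit_val (f x).
Proof. by rewrite /real_ext unit_valK. Qed.

Lemma dist_le_rho f g (x : unit_itv R) : `|unit_val (f x) - unit_val (g x)| <= rho f g.
Proof.
apply: ub_le_sup; last by exists x.
exists 1 => _ [y _ <-]; rewrite ler_norml.
by have := unit_valP (f y); have := unit_valP (g y); lra.
Qed.

Lemma rho_le f g c :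
  (forall x : unit_itv R, `|unit_val (f x) - unit_val (g x)| <= c) -> rho f g <= c.
Proof.
move=> fgc; apply: ge_sup => [|_ [x _ <-]]; last exact: fgc.
by exists `|unit_val (f (to_unit 0)) - unit_val (g (to_unit 0))|, (to_unit 0).
Qed.

End dynamics.

Notation iter_ext n f := (real_ext (Clambda_iter n f)).

(** * From covering to periodic specification *)

Section specification.
Context {R : realType}.
Implicit Types (r s t x y : R) (f g : Clambda R) (F : R -> R).

(** Moving from [x] towards [q], stop as soon as [F] is at distance [e] from its
    value at [x]. *)
Lemma first_exit F x q e : continuous F -> 0 <= x <= 1 -> 0 <= q <= 1 ->
  0 <= e -> e <= `|F q - F x| ->
  exists2 p, 0 <= p <= 1 & e = `|F p - F x| /\
    forall w, Num.min x p <= w <= Num.max x p -> `|F w - F x| <= e.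
Proof.
move=> cF x01 q01 e0 eq.
have cphi : continuous (fun r => - `|F r - F x|).
  move=> r; apply: cvgN; apply: cvg_norm; apply: cvgB; [exact: cF|exact: cvg_cst].
have [xq|/ltW qx] := leP x q.
- have cpsi : continuous (fun r => - `|F (- r) - F x|).
    move=> r; apply: (@continuous_comp _ _ _ -%R (fun r => - `|F r - F x|)); last exact: cphi.
    exact: oppr_continuous.
  have [||z zx [Ez zP]] := @last_passage R _ (- q) (- x) (- e) cpsi; first lra.
    by rewrite !opprK subrr normr0; lra.
  exists (- z); first lra.
  split=> [|w]; first lra.
  rewrite min_l ?max_r; [|lra..] => hw.
  by have := zP (- w); rewrite opprK; lra.
- have [|z zx [Ez zP]] := @last_passage R _ q x (- e) cphi qx.
    by rewrite subrr normr0; lra.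
  exists z; first lra.
  split=> [|w]; first lra.
  rewrite min_r ?max_l; [|lra..] => hw.
  by have := zP w; lra.
Qed.

(** Since the remaining m - i iterations do not shrink intervals, two points that
    are far apart after i steps give points of the same interval that are at
    least as far apart after m steps. *)
Lemma iterate_gap_le f s t i m c : 0 <= s -> s <= t -> t <= 1 -> (i <= m)%N ->
  (forall z w, s <= z <= t -> s <= w <= t ->
     iter_ext m f w - iter_ext m f z <= c) -> 0 <= c ->
  forall z w, s <= z <= t -> s <= w <= t ->
     iter_ext i f w - iter_ext i f z <= c.
Proof.
move=> s0 st t1 im hc c0 z w hz hw.
have ci := @continuous_real_ext R (Clambda_iter i f).
have [wz|zw] := leP (iter_ext i f w) (iter_ext i f z); first lra.
have [|||u [v [hu hv uv]]] := @nonshrinking R (Clambda_iter (m - i) f) (iter_ext i f z)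
  (iter_ext i f w).
- by case/andP: (real_ext01 (Clambda_iter i f) z).
- exact: ltW.
- by case/andP: (real_ext01 (Clambda_iter i f) w).
have [u' su Eu] := intermediate_value ci hz hw hu.
have [v' sv Ev] := intermediate_value ci hz hw hv.
have := hc _ _ su sv; rewrite -(subnK im) !real_ext_iterD Eu Ev; lra.
Qed.

(** Stopping when the m-th iterate has moved by [e] makes the m-th image of the
    interval have length at least [e], while its diameter is at most 2e; by
    [iterate_gap_le] the earlier images are then no wider. *)
Lemma shadowing_interval f e m x : 0 < e -> e <= 1/2 -> 0 <= x <= 1 ->
  exists s t, [/\ 0 <= s, s <= t, t <= 1,
    (forall z i, s <= z <= t -> (i <= m)%N ->
      `|iter_ext i f z - iter_ext i f x| <= 2 * e) &
    spread (iter_ext m f) s t e].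
Proof.
move=> e0 e1 x01; have cm := @continuous_real_ext R (Clambda_iter m f).
have [q q01 hq] : exists2 q, 0 <= q <= 1 & e <= `|iter_ext m f q - iter_ext m f x|.
  have [u [v [hu hv uv]]] := nonshrinking (Clambda_iter m f) (lexx 0) ler01 (lexx (1 : R)).
  have [hx|hx] := leP (iter_ext m f u + 1/2) (iter_ext m f x).
    by exists u => //; rewrite distrC ger0_norm; lra.
  by exists v => //; rewrite ger0_norm; lra.
have [p p01 [ep hp]] := first_exit cm x01 q01 (ltW e0) hq.
have xP : Num.min x p <= x <= Num.max x p by rewrite ge_min le_max lexx.
have pP : Num.min x p <= p <= Num.max x p by rewrite ge_min le_max lexx !orbT.
have sm : 0 <= Num.min x p by rewrite le_min; lra.
have tm : Num.max x p <= 1 by rewrite ge_max; lra.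
exists (Num.min x p), (Num.max x p); split=> //; first lra.
  move=> z i hz im; rewrite ler_norml.
  have hc z' w' : Num.min x p <= z' <= Num.max x p -> Num.min x p <= w' <= Num.max x p ->
     iter_ext m f w' - iter_ext m f z' <= 2 * e.
    by move=> /hp + /hp; rewrite !ler_norml; lra.
  have := iterate_gap_le sm _ tm im hc _ xP hz.
  have := iterate_gap_le sm _ tm im hc _ hz xP.
  lra.
have [h|h] := leP (iter_ext m f x) (iter_ext m f p).
  by exists x, p; split=> //; rewrite ep ger0_norm; lra.
by exists p, x; split=> //; rewrite ep ltr0_norm; lra.
Qed.

Definition covers f (e : R) (N : nat) := forall s t, 0 <= s -> t <= 1 -> e <= t - s ->
  forall n, (N <= n)%N -> forall v, 0 <= v <= 1 ->
  exists2 z, s <= z <= t & iter_ext n f z = v.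

Lemma spread_covers f e N s t m n v : covers f e N ->
  0 <= s -> t <= 1 ->
  spread (iter_ext m f) s t e -> (m + N <= n)%N -> 0 <= v <= 1 ->
  exists2 z, s <= z <= t & iter_ext n f z = v.
Proof.
move=> cov s0 t1 [x [y [hx hy exy]]] mn v01.
have x0 : 0 <= iter_ext m f x by case/andP: (real_ext01 (Clambda_iter m f) x).
have y1 : iter_ext m f y <= 1 by case/andP: (real_ext01 (Clambda_iter m f) y).
have Nn : (N <= n - m)%N by move: mn; clear; lia.
have [w hw <-] := cov _ _ x0 y1 exy _ Nn v v01.
have [z hz <-] := intermediate_value (@continuous_real_ext R (Clambda_iter m f)) hx hy hw.
by exists z => //; rewrite -real_ext_iterD subnK// (leq_trans (leq_addr _ _) mn).
Qed.

(** The point whose orbit shadows all segments is found backwards. The shadowing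
    interval of the first segment covers [0, 1] after the gap, in particular it
    covers the interval built for the later segments; a subinterval that is
    mapped exactly onto the latter shadows the first segment as well. Segments
    are indexed by nat here so that the induction can shift them. *)
Lemma nested_covering f e N : 0 < e -> e <= 1/2 -> covers f e N ->
  forall n (a b : nat -> nat) (X : nat -> R),
  (forall j, (j <= n)%N -> (a j <= b j)%N) ->
  (forall j, (j < n)%N -> (b j + N <= a j.+1)%N) ->
  (forall j, 0 <= X j <= 1) ->
  (forall j, (j <= n)%N -> (a 0 <= a j)%N) /\
  exists s t, [/\ 0 <= s, s <= t, t <= 1,
    (forall z j k, s <= z <= t -> (j <= n)%N -> (k <= b j - a j)%N ->
      `|iter_ext (a j - a 0 + k)%N f z - iter_ext k f (X j)| <= 2 * e) &
    (forall v, 0 <= v <= 1 ->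
      exists2 z, s <= z <= t & iter_ext (b n - a 0 + N)%N f z = v)].
Proof.
move=> e0 e1 cov; elim=> [|n IH] a b X ab ba X01.
  split; first by move=> j; rewrite leqn0 => /eqP ->.
  have [s [t [s0 st t1 sh sp]]] := shadowing_interval f (b 0 - a 0)%N e0 e1 (X01 0%N).
  exists s, t; split=> //.
    by move=> z j k hz; rewrite leqn0 => /eqP -> hk; rewrite subnn add0n; exact: sh.
  by move=> v v01; exact: (spread_covers cov s0 t1 sp (leqnn _) v01).
have [|||amon [s1 [t1 [s10 st1 t11 sh1 on1]]]] :=
  IH (fun j => a j.+1) (fun j => b j.+1) (fun j => X j.+1).
- by move=> j jn; exact: ab.
- by move=> j jn; exact: ba.
- by move=> j; exact: X01.
have ab0 := ab 0%N (leq0n _); have ba0 := ba 0%N (ltn0Sn _).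
have a01 : (a 0 <= a 1)%N by move: ab0 ba0; clear; lia.
split.
  by case=> // j jn; apply: leq_trans a01 _; exact: amon.
have [s [t [s0 st tl sh sp]]] := shadowing_interval f (b 0 - a 0)%N e0 e1 (X01 0%N).
have on v : 0 <= v <= 1 -> exists2 z, s <= z <= t & iter_ext (a 1 - a 0)%N f z = v.
  by move=> v01; apply: (spread_covers cov s0 tl sp _ v01); move: ab0 ba0; clear; lia.
have [|x hx Ex] := on s1; first lra.
have [|y hy Ey] := on t1; first lra.
have [s' [t' [ss st' tt h1 h2]]] :=
  subinterval_onto (@continuous_real_ext R (Clambda_iter (a 1 - a 0)%N f)) hx hy st1 Ex Ey.
exists s', t'; split; try lra.
  move=> z [|j] k hz jn hk; first by rewrite subnn add0n; apply: sh => //; lra.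
  have /= aj := amon j jn.
  rewrite (_ : (a j.+1 - a 0 + k = a j.+1 - a 1 + k + (a 1 - a 0))%N); last first.
    by move: a01 aj; clear; lia.
  by rewrite real_ext_iterD; apply: sh1 => //; exact: h1.
move=> v /on1[w hw <-]; have [z hz <-] := h2 w hw.
exists z => //; rewrite -real_ext_iterD; congr (iter_ext _ f z).
have := amon n (leqnn n); have := ab n.+1 (leqnn _); move: a01; clear; lia.
Qed.

(** The interval of [nested_covering] is mapped onto [0, 1] after p steps, p being
    the required period, so the p-th iterate has a fixed point z in it. That point
    is the position at time a_0 of the wanted orbit, which starts at
    f^(a_0 p - a_0)(z). *)
Lemma covers_specification f :
  (forall e, 0 < e -> exists N, covers f e N) -> periodic_specification_property f.
Proof.
move=> cov eps eps0.
(* 2e bounds the shadowing error; e <= 1/2 ensures that some point is at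
   distance e from any given one. *)
pose e := Num.min (eps / 2) (1/2).
have e0 : 0 < e by rewrite lt_min; lra.
have e1 : e <= 1/2 by rewrite ge_min lexx orbT.
have e2 : 2 * e <= eps by have : e <= eps / 2 by [rewrite ge_min lexx]; lra.
have [N covN] := cov e e0.
(* The length of the gaps has to be positive, also to make p positive. *)
have {}covN : covers f e N.+1 by move=> s t s0 t1 st n Nn; apply: covN => //; exact: ltnW.
exists N.+1 => // n a b x [ab ba].
pose a' j := a (inord j); pose b' j := b (inord j).
pose X j := unit_val (iter (a' j) f (x (inord j))).
have [|||amon [s [t [s0 st t1 sh on]]]] := nested_covering e0 e1 covN (n := n) (a :=
  a') (b := b') (X := X).
- by move=> j _; exact: ab.
- move=> j jn; by apply: ba; rewrite !inordK// ltnS ltnW.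
- by move=> j; exact: unit_valP.
set p := (_ + N.+1)%N in on.
have [|u hu Eu] := on 0; first lra.
have [|v hv Ev] := on 1; first lra.
have cP : continuous (fun r => iter_ext p f r - r).
  by move=> r; apply: cvgB; [exact: continuous_real_ext|exact: cvg_id].
have [|z hz Ez] := @intermediate_value R _ s t u v 0 cP hu hv; first by rewrite Eu Ev; lra.
have {}Ez : iter_ext p f z = z by lra.
have z01 : 0 <= z <= 1 by lra.
pose w := to_unit z.
have fw : iter p f w = w.
  by apply: unit_val_inj; rewrite -Clambda_iterE [RHS]to_unitK.
have fkw k : iter (k * p) f w = w by elim: k => // k IH; rewrite mulSn iterD IH.
have i0 : inord 0%N = ord0 :> 'I_n.+1 by apply: val_inj; rewrite /= inordK.
have im : inord n = ord_max :> 'I_n.+1 by apply: val_inj; rewrite /= inordK.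
have ap : (a' 0%N <= a' 0%N * p)%N by rewrite leq_pmulr// /p addnS.
have fa : iter (a' 0%N) f (iter (a' 0%N * p - a' 0)%N f w) = w.
  by rewrite -iterD subnKC.
exists (iter (a' 0%N * p - a' 0)%N f w); last first.
  rewrite (_ : (_ + _)%N = p); last by rewrite /p /a' /b' i0 im.
  by rewrite -iterD addnC iterD fw.
move=> i k /andP[aik kbi].
have ii : inord i = i :> 'I_n.+1 by rewrite inord_val.
have ai : a' i = a i by rewrite /a' ii.
have bi : b' i = b i by rewrite /b' ii.
have i_n : (i <= n)%N by rewrite -ltnS.
have a0i := amon i i_n.
have -> : iter k f (iter (a' 0%N * p - a' 0)%N f w) = iter (a' i - a' 0%N + (k - a' i)) f w.
  rewrite -[in RHS]fa -[RHS]iterD; congr (iter _ _ _); move: aik a0i; rewrite ai; clear; lia.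
have -> : iter k f (x i) = iter (k - a' i) f (iter (a' i) f (x i)).
  by rewrite -iterD subnK// ai.
apply: le_trans e2.
have := sh z i (k - a' i)%N hz i_n; rewrite /real_ext !Clambda_iterE /X unit_valK ii.
by apply; rewrite ai bi leq_sub2r.
Qed.

End specification.

(** * The residual set *)

Section generic.
Context {R : realType}.
Implicit Types (r s t x y : R) (f g : Clambda R) (F : R -> R).

Lemma near_rho f e : 0 < e -> \forall g \near f, rho f g < e.
Proof. by move=> e0; apply/nbhs_ballP; exists e => // g; rewrite ballEmdist. Qed.

(** For a fixed number of iterations, the iterate at one point depends continuously
    on the map for the uniform distance. *)
Lemma cvg_eval n r f : (fun g => iter_ext n g r) @ f --> iter_ext n f r.
Proof.
elim: n => [|n IH]; apply/(@cvgrPdist_lt _ _ _ (nbhs f)) => e e0.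
  by apply: filterE => g; rewrite subrr normr0.
have e2 : 0 < e / 2 by lra.
have cf : (fun g => real_ext f (iter_ext n g r)) @ f --> real_ext f (iter_ext n f r).
  apply: cvg_comp; [exact: IH|exact: (@continuous_real_ext R f)].
near=> g; rewrite !real_ext_iterS.
have h1 : `|real_ext f (iter_ext n f r) - real_ext f (iter_ext n g r)| < e / 2.
  by near: g; move/(@cvgrPdist_lt _ _ _ (nbhs f)) : cf; exact.
have h2 : rho f g < e / 2 by near: g; exact: near_rho.
have := dist_le_rho f g (to_unit (iter_ext n g r)).
rewrite -/(real_ext f _) -/(real_ext g _).
move: h1 h2; rewrite !ltr_norml ler_norml; lra.
Unshelve. all: by end_near. Qed.

(** Near such a map, 0 and 1 still have all their preimages away from the ends
    of [0, 1]. *)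
Definition escaping : set (Clambda R) :=
  [set f | 0 < real_ext f 0 < 1 /\ 0 < real_ext f 1 < 1].

(** Intervals are tested on a finite grid, and the witnesses are finitely many
    orbits, which makes the condition open by [cvg_eval]. *)
Definition spreading k : set (Clambda R) :=
  [set f | exists N, forall i : 'I_k.+1, exists x y,
    [/\ i%:R / k.+1%:R <= x <= i.+1%:R / k.+1%:R,
        i%:R / k.+1%:R <= y <= i.+1%:R / k.+1%:R &
        1 - k.+1%:R^-1 < iter_ext N f y - iter_ext N f x]].

Lemma open_escaping : open escaping.
Proof.
have cl r : continuous (fun f : Clambda R => real_ext f r).
  rewrite (_ : (fun f : Clambda R => real_ext f r) = (fun f :
    Clambda R => iter_ext 1%N f r)); first by move=> f; exact: cvg_eval.
  by apply/funext => f; rewrite real_ext_iterS /real_ext unit_valK.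
have ol r : open [set f : Clambda R | 0 < real_ext f r < 1].
  rewrite (_ : [set f : Clambda R | _] = (fun f : Clambda R => real_ext f r) @^-1` `]0, 1[).
    by apply: open_comp => [f _|]; [exact: cl|exact: interval_open].
  by apply/seteqP; split=> f; rewrite /= in_itv.
exact: (openI (ol 0) (ol 1)).
Qed.

Lemma open_spreading k : open (spreading k).
Proof.
rewrite openE => f [N fN]; rewrite /interior.
suff : \forall g \near f, forall i : 'I_k.+1, exists x y,
    [/\ i%:R / k.+1%:R <= x <= i.+1%:R / k.+1%:R,
        i%:R / k.+1%:R <= y <= i.+1%:R / k.+1%:R &
        1 - k.+1%:R^-1 < iter_ext N g y - iter_ext N g x].
  by apply: filterS => g gN; exists N.
apply: (@filter_forall _ _ _ (nbhs f)) => i; have [x [y [ix iy xy]]] := fN i.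
have : \forall g \near f, 1 - k.+1%:R^-1 < iter_ext N g y - iter_ext N g x.
  exact: (cvgr_gt _ (cvgB (@cvg_eval N y f) (@cvg_eval N x f))).
by apply: (@filterS _ (nbhs f)) => g gxy; exists x, y.
Qed.

Lemma Clambda_onto f v : 0 <= v <= 1 -> exists2 z, 0 <= z <= 1 & real_ext f z = v.
Proof.
move=> v01; have [x [y [x01 y01 xy]]] := nonshrinking f (lexx 0) ler01 (lexx (1 : R)).
apply: (intermediate_value (@continuous_real_ext R f) x01 y01).
by have := real_ext01 f x; have := real_ext01 f y; lra.
Qed.

Lemma escaping_margin f : escaping f -> exists2 d, 0 < d & forall r,
  0 <= r <= 1 -> r <= d \/ 1 - d <= r -> 0 < real_ext f r < 1.
Proof.
move=> [f0 f1].
have h r : 0 < real_ext f r < 1 -> \forall w \near r, 0 < real_ext f w < 1.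
  move=> /andP[r0 r1]; near=> w; apply/andP; split; near: w.
    exact: (cvgr_gt _ (@continuous_real_ext R f r)).
  exact: (cvgr_lt _ (@continuous_real_ext R f r)).
have [d0 /= d00 h0] := (nbhs_ballP _ _).1 (h _ f0).
have [d1 /= d10 h1] := (nbhs_ballP _ _).1 (h _ f1).
exists (Num.min d0 d1 / 2); first by rewrite divr_gt0// lt_min d00.
have m0 : Num.min d0 d1 <= d0 by rewrite ge_min lexx.
have m1 : Num.min d0 d1 <= d1 by rewrite ge_min lexx orbT.
move=> r r01 [rd|rd]; [apply: h0|apply: h1]; rewrite /ball /= ltr_norml; lra.
Unshelve. all: by end_near. Qed.

(** An interval of length e contains a cell of a fine grid, whose image at time N
    contains [d, 1 - d]. The preimages of 0 and 1 lie there because [f] is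
    escaping, so that one more step gives all of [0, 1], and it stays so because
    [f] is onto. *)
Lemma generic_covers f : escaping f -> (forall k, spreading k f) ->
  forall e, 0 < e -> exists N, covers f e N.
Proof.
move=> /escaping_margin[d d0 hd] sp e e0.
have m0 : 0 < Num.min (e / 2) d by rewrite lt_min; lra.
pose k := Num.truncn (Num.min (e / 2) d)^-1.
have k0 : 0 < k.+1%:R :> R by [].
have kP : k.+1%:R^-1 < Num.min (e / 2) d.
  rewrite -[X in _ < X]invrK ltf_pV2 ?posrE ?invr_gt0//.
  have m1 : 0 <= (Num.min (e / 2) d)^-1 by rewrite invr_ge0 ltW.
  by have /andP[] := truncn_itv m1.
have [ke kd] : k.+1%:R^-1 < e / 2 /\ k.+1%:R^-1 < d by apply/andP; rewrite -lt_min.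
have [N spN] := sp k.
exists N.+1 => s t s0 t1 st n Nn v v01.
(* The j-th cell is the first one whose left end is beyond s. *)
pose j := (Num.truncn (s * k.+1%:R)).+1.
have /andP[jlo jhi] : (Num.truncn (s * k.+1%:R))%:R <= s * k.+1%:R < j%:R.
  by apply: truncn_itv; rewrite mulr_ge0.
have jE : j%:R = (Num.truncn (s * k.+1%:R))%:R + 1 :> R by rewrite /j -natr1.
have sj : s <= j%:R / k.+1%:R by rewrite ler_pdivlMr// ltW.
have jt : j.+1%:R / k.+1%:R <= t.
  have : (j.+1%:R - s * k.+1%:R) / k.+1%:R <= 2 / k.+1%:R.
    by rewrite ler_pM2r ?invr_gt0// -natr1 jE; lra.
  rewrite mulrBl mulfK ?gt_eqF//; move: (k.+1%:R^-1) (j.+1%:R) ke st => K J; lra.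
have jk : (j < k.+1)%N.
  by have := le_trans jt t1; rewrite ler_pdivrMr// mul1r ler_nat.
have [x [y [hx hy xy]]] := spN (Ordinal jk); rewrite /= in hx hy xy.
(* The preimages of 0 and 1 avoid the margins, hence lie in the N-th image. *)
have hN w r : 0 <= w <= 1 -> r = 0 \/ r = 1 -> real_ext f w = r ->
  iter_ext N f x <= w <= iter_ext N f y.
  move=> w01 r01 Ew; have := real_ext01 (Clambda_iter N f) x;
    have := real_ext01 (Clambda_iter N f) y.
  have := hd w w01; rewrite Ew.
  have [wd|dw] := leP w d; first by move=> /(_ (or_introl isT)); lra.
  have [wd'|dw'] := leP (1 - d) w; first by move=> /(_ (or_intror isT)); lra.
  by move: kd xy; move: (k.+1%:R^-1) => K kd xy _; lra.
have [|w0 w001 Ew0] := @Clambda_onto f 0; first lra.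
have [|w1 w101 Ew1] := @Clambda_onto f 1; first lra.
have [w hw <-] := Clambda_onto (Clambda_iter (n - N.+1) f) v01.
have [z /andP[z0 z1] <-] : exists2 z, iter_ext N f x <= z <= iter_ext N f y & real_ext f z = w.
  apply: (@intermediate_value R (real_ext f) _ _ w0 w1) => //.
  - exact: continuous_real_ext.
  - by apply: (hN _ 0) => //; left.
  - by apply: (hN _ 1) => //; right.
  - by rewrite Ew0 Ew1.
have [u hu Eu] : exists2 u, s <= u <= t & iter_ext N f u = z.
  have inst w' : j%:R / k.+1%:R <= w' <= j.+1%:R / k.+1%:R -> s <= w' <= t.
    by case/andP=> jw wj; rewrite (le_trans sj jw) (le_trans wj jt).
  apply: (@intermediate_value R (iter_ext N f) _ _ x y) => //.
  - exact: continuous_real_ext.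
  - exact: inst.
  - exact: inst.
  - exact/andP.
exists u => //; rewrite -[n in Clambda_iter n f](subnK Nn) real_ext_iterD real_ext_iterS Eu//.
Qed.
End generic.

(** * Threefold zigzags *)

Section zigzag.
Context {R : realType}.
Implicit Types (r s t x y c d : R) (f g : Clambda R) (F : R -> R).
Local Notation mu := (@lebesgue_measure R).

Lemma continuous_affine (a b : R) : continuous (fun x => a * x + b).
Proof.
move=> x; apply: cvgD; last exact: cvg_cst.
by apply: cvgM; [exact: cvg_cst|exact: cvg_id].
Qed.

(** The identity outside [c, d]; on [c, d], the map with three affine laps of slopes
    3, -3, 3, each of them onto [c, d]. Writing it with minima and maxima makes
    its continuity immediate. *)
Definition zig c d x := Num.min (Num.max x d)
  (Num.max (Num.min x c)
    (Num.max (Num.min (3 * x + - (2 * c)) (- 3 * x + (2 * c + 2 * d))) (3 * x + - (2 * d)))).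

Lemma continuous_zig c d : continuous (zig c d).
Proof.
have ci : continuous (fun x : R => x) by move=> x; exact: cvg_id.
have cc (a : R) : continuous (fun x : R => a) by move=> x; exact: cvg_cst.
apply: min_fun_continuous; first exact: max_fun_continuous.
apply: max_fun_continuous; first exact: min_fun_continuous.
apply: max_fun_continuous; last exact: continuous_affine.
by apply: min_fun_continuous; exact: continuous_affine.
Qed.

Ltac minmax := rewrite !minEle !maxEle; repeat (case: ifPn); lra.

Lemma zig_out c d x : c <= d -> x <= c \/ d <= x -> zig c d x = x.
Proof. by rewrite /zig => cd [xc|dx]; minmax. Qed.

Lemma zig1 c d x : c <= x -> 3 * x <= 2 * c + d -> zig c d x = 3 * x - 2 * c.
Proof. by rewrite /zig => h1 h2; minmax. Qed.

Lemma zig2 c d x : 2 * c + d <= 3 * x -> 3 * x <= c + 2 * d ->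
  zig c d x = 2 * c + 2 * d - 3 * x.
Proof. by rewrite /zig => h1 h2; minmax. Qed.

Lemma zig3 c d x : c + 2 * d <= 3 * x -> x <= d -> zig c d x = 3 * x - 2 * d.
Proof. by rewrite /zig => h1 h2; minmax. Qed.

Variant zig_spec c d x : R -> Prop :=
| ZigOut of x <= c \/ d <= x : zig_spec c d x x
| Zig1 of c < x & 3 * x <= 2 * c + d : zig_spec c d x (3 * x - 2 * c)
| Zig2 of 2 * c + d < 3 * x & 3 * x <= c + 2 * d : zig_spec c d x (2 * c + 2 * d - 3 * x)
| Zig3 of c + 2 * d < 3 * x & x < d : zig_spec c d x (3 * x - 2 * d).

Lemma zigP c d x : c <= d -> zig_spec c d x (zig c d x).
Proof.
move=> cd.
have [xc|cx] := leP x c; first by rewrite zig_out; [constructor; left|..|left].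
have [dx|xd] := leP d x; first by rewrite zig_out; [constructor; right|..|right].
have [h1|h1] := leP (3 * x) (2 * c + d); first by rewrite zig1 ?(ltW cx)//; constructor.
have [h2|h2] := leP (3 * x) (c + 2 * d); first by rewrite zig2 ?(ltW h1)//; constructor.
by rewrite zig3 ?(ltW h2) ?(ltW xd)//; constructor.
Qed.

Lemma zig_keeps c d x : c <= x <= d -> c <= zig c d x <= d.
Proof.
move=> cxd; have cd : c <= d by lra.
by have [h|h h'|h h'|h h'] := zigP x cd; lra.
Qed.

Lemma zig01 c d x : 0 <= c -> c <= d -> d <= 1 -> 0 <= x <= 1 -> 0 <= zig c d x <= 1.
Proof. by move=> c0 cd d1 x01; have [h|h h'|h h'|h h'] := zigP x cd; lra. Qed.

(** For c < t <= d the sublevel set consists of [0, c] prolonged along the first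
    lap, and of a neighbourhood of the valley between the last two laps; the lengths
    (2c + t) / 3 and 2 (t - c) / 3 add up to t. *)
Lemma zig_cdf c d t : 0 <= c -> c <= d -> d <= 1 -> 0 < t <= 1 ->
  mu (`[0, 1] `&` [set r | zig c d r < t]) = t%:E.
Proof.
move=> c0 cd d1 t01.
have [tc|ct] := leP t c.
  rewrite (_ : _ `&` _ = `[0, t[%classic); first by rewrite mu_itvco ?subr0//; lra.
  apply/seteqP; split=> r /=; rewrite !in_itv /=;
    by have [h|h h'|h h'|h h'] := zigP r cd; [case|..]; lra.
have [td|dt] := leP t d; last first.
  rewrite (_ : _ `&` _ = `[0, t[%classic); first by rewrite mu_itvco ?subr0//; lra.
  apply/seteqP; split=> r /=; rewrite !in_itv /=;
    by have [h|h h'|h h'|h h'] := zigP r cd; lra.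
rewrite (_ : _ `&` _ = `[0, (2 * c + t) / 3[%classic `|`
    `](2 * c + 2 * d - t) / 3, (2 * d + t) / 3[%classic).
  rewrite measureU//=.
  - rewrite [X in (X + _)%E]mu_itvco; last lra.
    rewrite [X in (_ + X)%E]mu_itvoo; last lra.
    by rewrite -EFinD; congr EFin; lra.
  - by apply/seteqP; split=> r //=; rewrite !in_itv /=; lra.
apply/seteqP; split=> r /=; rewrite !in_itv /=;
  by have [h|h h'|h h'|h h'] := zigP r cd; lra.
Qed.

Lemma Clambda_zig c d : 0 <= c -> c <= d -> d <= 1 ->
  exists g, forall r, 0 <= r <= 1 -> real_ext g r = zig c d r.
Proof.
move=> c0 cd d1; apply: Clambda_of_cdf.
- exact: continuous_zig.
- by move=> r; exact: zig01.
- by move=> t; exact: zig_cdf.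
Qed.

(** Positive exactly inside the window [w], where it is the distance to the
    complement. *)
Definition depth (w : R * R) x := Num.min (x - w.1) (w.2 - x).

(** The turning point [p] leaves at least half of the interval on one of its sides,
    where the slope is 3 or -3. *)
Lemma zig_two_laps c d s t p : s <= t ->
   (forall x, s <= x <= t -> zig c d x = zig c d p - 3 * `|x - p|) \/
   (forall x, s <= x <= t -> zig c d x = zig c d p + 3 * `|x - p|) ->
  spread (zig c d) s t (3 / 2 * (t - s)).
Proof.
move=> st h.
have [sp|ps] := leP s p; have [tp|pt] := leP p t; last by lra.
- have [sm|ms] := leP (p - s) (t - p).
    by case: h => h; [exists t, p|exists p, t]; split; rewrite ?(h t) ?ger0_norm; lra.
  by case: h => h; [exists s, p|exists p, s]; split; rewrite ?(h s) ?ler0_norm; lra.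
- case: h => h; [exists s, t|exists t, s]; split; rewrite ?(h s) ?(h t); try lra;
    rewrite !ler0_norm; lra.
- case: h => h; [exists t, s|exists s, t]; split; rewrite ?(h s) ?(h t); try lra;
    rewrite !ger0_norm; lra.
Qed.

(** Either [s, t] lies on two adjacent laps and is stretched by 3/2, or each end
    lying in the window is pushed outwards: for [s], either the valley, of value c,
    belongs to the interval, or [s] is on the last lap, where the map is below the
    identity; for [t], symmetrically. In the second case the image contains [s, t],
    so that later zigzags can be applied to the same interval. *)
Lemma zig_dichotomy c d s t : c <= d -> s <= t ->
  spread (zig c d) s t (3 / 2 * (t - s)) \/
  exists x y, [/\ s <= x <= t, s <= y <= t,
    zig c d x <= s /\ zig c d x <= s - depth (c, d) s &
    t <= zig c d y /\ t + depth (c, d) t <= zig c d y].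
Proof.
move=> cd st; rewrite /depth /=.
have hd z a b : a <= z \/ b <= z -> Num.min a b <= z :> R.
  by rewrite ge_min => -[->|->]; rewrite ?orbT.
have [laps|nlaps] := pselect (c < s /\ 3 * t < c + 2 * d).
  left; apply: (@zig_two_laps _ _ _ _ ((2 * c + d) / 3)) => //; left=> x hx.
  rewrite (@zig1 c d (_ / 3)); [|lra..].
  have [h|h] := leP (3 * x) (2 * c + d).
    by rewrite zig1 ?ler0_norm; lra.
  by rewrite zig2 ?ger0_norm; lra.
have [laps|nlaps'] := pselect (2 * c + d < 3 * s /\ t < d).
  left; apply: (@zig_two_laps _ _ _ _ ((c + 2 * d) / 3)) => //; right=> x hx.
  rewrite (@zig3 c d (_ / 3)); [|lra..].
  have [h|h] := leP (3 * x) (c + 2 * d).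
    by rewrite zig2 ?ler0_norm; lra.
  by rewrite zig3 ?ger0_norm; lra.
right.
have [x hx [x1 x2]] : exists2 x, s <= x <= t &
  zig c d x <= s /\ zig c d x <= s - Num.min (s - c) (d - s).
  have [h|h] := pselect (c < s /\ 3 * s <= c + 2 * d).
    exists ((c + 2 * d) / 3); first by lra.
    rewrite zig3; [|lra..]; split; first lra.
    by rewrite lerBrDr -lerBrDl; apply: hd; lra.
  exists s; first lra.
  have [h'|h1 h'|h1 h'|h1 h'] := zigP s cd; try lra.
    by split => //; rewrite lerBrDr -lerBrDl; apply: hd; lra.
  by split; [lra|rewrite lerBrDr -lerBrDl; apply: hd; lra].
have [y hy [y1 y2]] : exists2 y, s <= y <= t &
  t <= zig c d y /\ t + Num.min (t - c) (d - t) <= zig c d y.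
  have [h|h] := pselect (2 * c + d <= 3 * t /\ t < d).
    exists ((2 * c + d) / 3); first by lra.
    rewrite zig1; [|lra..]; split; first lra.
    by rewrite -lerBrDl; apply: hd; lra.
  exists t; first lra.
  have [h'|h1 h'|h1 h'|h1 h'] := zigP t cd; try lra.
    by split => //; rewrite -lerBrDl; apply: hd; lra.
  by split; [lra|rewrite -lerBrDl; apply: hd; lra].
by exists x, y.
Qed.

End zigzag.

(** * Perturbations of the identity *)

Section perturb.
Context {R : realType}.
Implicit Types (r s t x y c d : R) (f g : Clambda R) (F : R -> R).
Local Notation mu := (@lebesgue_measure R).

(** On [0, d], the map with two affine laps of slopes -2, 2, each onto [0, d]; the
    identity on the right of d. The only zero on the positive half-line is
    d / 2. *)
Definition vee d x := Num.min (Num.max (- 2 * x + d) (2 * x + - d)) (Num.max x d).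

Lemma continuous_vee d : continuous (vee d).
Proof.
have ci : continuous (fun x : R => x) by move=> x; exact: cvg_id.
have cc (a : R) : continuous (fun x : R => a) by move=> x; exact: cvg_cst.
apply: min_fun_continuous; last exact: max_fun_continuous.
by apply: max_fun_continuous; exact: continuous_affine.
Qed.

Variant vee_spec d x : R -> Prop :=
| Vee1 of 2 * x < d : vee_spec d x (d - 2 * x)
| Vee2 of d <= 2 * x & x <= d : vee_spec d x (2 * x - d)
| Vee3 of d < x : vee_spec d x x.

Lemma veeP d x : 0 <= x -> vee_spec d x (vee d x).
Proof.
move=> x0; have [h1|h1] := ltP (2 * x) d.
  rewrite (_ : vee d x = d - 2 * x); first by constructor.
  by rewrite /vee max_l ?max_r ?min_l; lra.
have [h2|h2] := leP x d.
  rewrite (_ : vee d x = 2 * x - d); first by constructor.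
  by rewrite /vee max_r ?max_r ?min_l; lra.
rewrite (_ : vee d x = x); first by constructor.
by rewrite /vee max_r ?max_l ?min_r; lra.
Qed.

Lemma Clambda_vee d : 0 < d -> d <= 1 -> exists g, forall r, 0 <= r <= 1 ->
  real_ext g r = vee d r.
Proof.
move=> d0 d1; apply: Clambda_of_cdf.
- exact: continuous_vee.
- by move=> r r01; have [h|h h'|h] := veeP d (andP r01).1; lra.
move=> t t01; have [td|dt] := leP t d.
  rewrite (_ : _ `&` _ = `](d - t) / 2, (d + t) / 2[%classic).
    by rewrite mu_itvoo; [congr EFin|]; lra.
  apply/seteqP; split=> r /=; rewrite !in_itv /=.
    by move=> [r01]; have [h|h h'|h] := veeP d (andP r01).1; lra.
  move=> rt; have r0 : 0 <= r by lra.
  by split; [lra|have [h|h h'|h] := veeP d r0; lra].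
rewrite (_ : _ `&` _ = `[0, t[%classic); first by rewrite mu_itvco ?subr0//; lra.
apply/seteqP; split=> r /=; rewrite !in_itv /=.
  by move=> [r01]; have [h|h h'|h] := veeP d (andP r01).1; lra.
move=> rt; have r0 : 0 <= r by lra.
  by split; [lra|have [h|h h'|h] := veeP d r0; lra].
Qed.

Lemma Clambda_flip : exists g, forall r, 0 <= r <= 1 -> real_ext g r = 1 - r.
Proof.
apply: Clambda_of_cdf.
- by move=> r; apply: cvgB; [exact: cvg_cst|exact: cvg_id].
- by move=> r; lra.
move=> t t01; rewrite (_ : _ `&` _ = `]1 - t, 1]%classic).
  by rewrite lebesgue_measure_itv /= lte_fin -EFinB ifT; [congr EFin|]; lra.
by apply/seteqP; split=> r /=; rewrite !in_itv /=; lra.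
Qed.

(** Fold the left end with [vee], and the right end with its conjugate by the
    reflection: the only points sent to 0 or 1 are d / 2 and 1 - d / 2. *)
Lemma folded_ends d : 0 < d -> d < 1 / 2 -> exists g, forall r, 0 <= r <= 1 ->
  `|real_ext g r - r| <= 2 * d /\
  (r != d / 2 -> r != 1 - d / 2 -> 0 < real_ext g r < 1).
Proof.
move=> d0 d2; have d1 : d <= 1 by lra.
have [v vE] := Clambda_vee d0 d1.
have [s sE] := Clambda_flip; exists (Clambda_comp v (Clambda_comp s (Clambda_comp v s))) => r r01.
have s01 : 0 <= 1 - r <= 1 by lra.
have w01 : 0 <= vee d (1 - r) <= 1 by rewrite -vE//; exact: real_ext01.
rewrite !real_ext_comp (sE r)// (vE (1 - r))// sE// vE; last lra.
set y := vee d (1 - r) in w01 *; have y0 : 0 <= 1 - y by lra.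
split.
  by rewrite ler_norml; move: y0; rewrite /y; have [h|h h'|h] := veeP d (andP s01).1 => y0;
    have [k|k k'|k] := veeP d y0; lra.
move=> /eqP r1 /eqP r2; move: y0; rewrite /y.
by have [h|h h'|h] := veeP d (andP s01).1 => y0; have [k|k k'|k] := veeP d y0; lra.
Qed.

(** Half of the smallest positive element works. *)
Lemma exists_avoiding (vs : seq R) b : 0 < b ->
  exists2 d, 0 < d < b & forall v, v \in vs -> d != v.
Proof.
move=> b0; have [m [m0 mb mP]] : exists m, [/\ 0 < m, m <= b & forall v, v \in vs ->
  0 < v -> m <= v].
  elim: vs => [|v vs [m [m0 mb mP]]]; first by exists b.
  have [v0|v0] := leP v 0.
    exists m; split=> // w; rewrite inE => /orP[/eqP ->|]; [lra|exact: mP].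
  exists (Num.min m v); split; first by rewrite lt_min m0.
    by rewrite ge_min mb.
  move=> w; rewrite inE => /orP[/eqP -> _|wv w0]; first by rewrite ge_min lexx orbT.
  by rewrite ge_min mP.
exists (m / 2) => [|v vvs]; first by lra.
by apply/eqP => mv; have := mP _ vvs; lra.
Qed.

Definition zigs (ws : seq (R * R)) r := foldl (fun r w => zig w.1 w.2 r) r ws.

Definition window (w : R * R) := [/\ 0 <= w.1, w.1 <= w.2 & w.2 <= 1].

Lemma Clambda_zigs ws : (forall w, w \in ws -> window w) ->
  exists g, forall r, 0 <= r <= 1 -> real_ext g r = zigs ws r.
Proof.
elim: ws => [|w ws IH] hws; first by exists Clambda_id => r r01; rewrite /real_ext to_unitK.
have [|g gE] := IH; first by move=> v vws; apply: hws; rewrite inE vws orbT.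
have [w0 w1 w2] := hws w (mem_head _ _).
have [z zE] := Clambda_zig w0 w1 w2.
by exists (Clambda_comp g z) => r r01; rewrite real_ext_comp zE// gE// zig01.
Qed.

Lemma zigs_nonshrinking ws s t : (forall w, w \in ws -> window w) -> s <= t ->
  spread (zigs ws) s t (t - s).
Proof.
elim: ws s t => [|w ws IH] s t hws st; first by exists s, t; split=> //=; rewrite lexx ?st.
have {}IH p q : p <= q -> spread (zigs ws) p q (q - p).
  by apply: IH => v vws; apply: hws; rewrite inE vws orbT.
have [w0 w1 w2] := hws w (mem_head _ _).
have cz := @continuous_zig R w.1 w.2; rewrite [zigs _](_ : _ = zigs ws \o zig w.1 w.2)//.
have [[x [y [hx hy xy]]]|[x [y [hx hy [x1 _] [y1 _]]]]] := zig_dichotomy w1 st.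
  apply: (spread_comp cz hx hy (lexx _) (lexx _)).
  have h : zig w.1 w.2 x <= zig w.1 w.2 y by lra.
  by apply: (spread_le _ (IH _ _ h)); lra.
exact: (spread_comp cz hx hy x1 y1 (IH _ _ st)).
Qed.

(** As long as the windows met so far have not stretched the interval, its image
    contains it, so the first window in which an end is deep acts on that same end.
    After that it suffices that the other zigzags do not shrink. *)
Lemma zigs_spread ws gamma s t : (forall w, w \in ws -> window w) -> s <= t ->
  (exists2 w, w \in ws & gamma <= depth w s \/ gamma <= depth w t) ->
  gamma <= (t - s) / 2 ->
  spread (zigs ws) s t (t - s + gamma).
Proof.
elim: ws => [|w ws IH] hws st [v]; first by rewrite in_nil.
have hws' u : u \in ws -> window u by move=> uws; apply: hws; rewrite inE uws orbT.
have [w0 w1 w2] := hws w (mem_head _ _).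
have cz := @continuous_zig R w.1 w.2; rewrite [zigs _](_ : _ = zigs ws \o zig w.1 w.2)//.
move=> vws dv gammat.
have [[x [y [hx hy xy]]]|[x [y [hx hy [x1 x2] [y1 y2]]]]] := zig_dichotomy w1 st.
  apply: (spread_comp cz hx hy (lexx _) (lexx _)).
  have h : zig w.1 w.2 x <= zig w.1 w.2 y by lra.
  by apply: (spread_le _ (zigs_nonshrinking hws' h)); lra.
move: vws; rewrite inE => /orP[/eqP vw|vws].
  subst v; rewrite -surjective_pairing in x2 y2.
  apply: (spread_comp cz hx hy (lexx _) (lexx _)).
  have h : zig w.1 w.2 x <= zig w.1 w.2 y by lra.
  by apply: (spread_le _ (zigs_nonshrinking hws' h)); lra.
apply: (spread_comp cz hx hy x1 y1); apply: IH => //; by exists v.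
Qed.

(** This is what prevents a long composition of zigzags from drifting away from the
    identity. *)
Lemma zigs_keeps ws p q x : (forall w, w \in ws -> w.1 <= w.2 /\
    [\/ w.2 <= p, q <= w.1 | w = (p, q)]) -> p <= x <= q ->
  p <= zigs ws x <= q.
Proof.
elim: ws x => //= w ws IH x hws xpq.
apply: IH => [v vws|]; first by apply: hws; rewrite inE vws orbT.
have [w12 [wp|qw|->]] := hws w (mem_head _ _).
- by rewrite zig_out//; right; lra.
- by rewrite zig_out//; left; lra.
- exact: zig_keeps.
Qed.

(** Consecutive windows of width 2u, shifted by [th] and clipped to [0, 1]. When
    2nu = 1, the windows of one phase have disjoint interiors, and the interiors of
    those of the phases 0 and u together cover the interior of the unit interval. *)
Definition phase_window (u th : R) (j : nat) : R * R :=
  (Num.max 0 (2 * (j%:R * u) - th), Num.min 1 (2 * (j%:R * u) + 2 * u - th)).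

Definition phase (u th : R) n := [seq phase_window u th j | j <- iota 0 n.+1].

Lemma natmul_le (u : R) i j : 0 < u -> (i <= j)%N -> i%:R * u <= j%:R * u.
Proof. by move=> u0 ij; rewrite ler_pM2r// ler_nat. Qed.

Lemma phase_windowP u th n w : 0 < u -> 2 * (n%:R * u) = 1 -> 0 <= th -> th <= u ->
  w \in phase u th n -> window w.
Proof.
move=> u0 nu th0 thu /mapP[j]; rewrite mem_iota add0n ltnS =>
  /andP[_ /(natmul_le u0) jn] ->; rewrite /phase_window.
have := natmul_le u0 (leq0n j); rewrite mul0r; move: (j%:R * u) jn => v jn v0.
split; rewrite /= ?le_max ?lexx// ?ge_min ?lexx//.
by rewrite ge_max !le_min; apply/andP; split; apply/andP; split; lra.
Qed.

(** Each point stays in the window of the phase that contains it. *)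
Lemma phase_close u th n x : 0 < u -> 2 * (n%:R * u) = 1 -> 0 <= th -> th <= u ->
  0 <= x <= 1 -> `|zigs (phase u th n) x - x| <= 2 * u.
Proof.
move=> u0 nu th0 thu x01; pose j := Num.truncn ((x + th) / (2 * u)).
have d0 : 0 < 2 * u by lra.
have /andP[jl jh] : j%:R <= (x + th) / (2 * u) < j.+1%:R.
  by apply: truncn_itv; rewrite divr_ge0; lra.
move: jl jh; rewrite ler_pdivlMr// ltr_pdivrMr// -natr1 => jl jh.
have jn : (j <= n)%N.
  rewrite leqNgt; apply/negP => /(natmul_le u0); rewrite -natr1; lra.
set w := phase_window u th j.
have xw : w.1 <= x <= w.2.
  by rewrite /= ge_max le_min; apply/andP; split; apply/andP; split; lra.
have : w.1 <= zigs (phase u th n) x <= w.2.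
  apply: zigs_keeps => // v vP; split; first by have [] := phase_windowP u0 nu th0 thu vP.
  move: vP => /mapP[i _ ->].
  have [ij|ji|->] := ltngtP i j; last by apply: Or33; rewrite -surjective_pairing.
    apply: Or31; rewrite /= le_max ge_min; apply/orP; right.
    by rewrite ge_min; apply/orP; right; have := natmul_le u0 ij; rewrite -natr1; lra.
  apply: Or32; rewrite /= le_max; apply/orP; right.
  by rewrite ge_min; apply/orP; right; have := natmul_le u0 ji; rewrite -natr1; lra.
have : w.2 <= w.1 + 2 * u.
  have h1 : w.2 <= 2 * (j%:R * u) + 2 * u - th by rewrite ge_min lexx orbT.
  have h2 : 2 * (j%:R * u) - th <= w.1 by rewrite le_max lexx orbT.
  lra.
by move=> hw hz; rewrite ler_norml; lra.
Qed.

Lemma phase_depth u th n j s gamma : (j <= n)%N -> gamma <= s -> s <= 1 - gamma ->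
  2 * (j%:R * u) - th + gamma <= s -> s <= 2 * (j%:R * u) + 2 * u - th - gamma ->
  exists2 w, w \in phase u th n & gamma <= depth w s.
Proof.
move=> jn s0 s1 sj js; exists (phase_window u th j).
  by apply: map_f; rewrite mem_iota.
rewrite /depth /phase_window /= le_min; apply/andP; split.
  by rewrite lerBrDl -lerBrDr ge_max; lra.
by rewrite lerBrDl le_min; lra.
Qed.

(** A point at distance at least u / 2 from the multiples of 2u is at depth u / 2 in
    an unclipped window of phase 0, and the other points in one of phase u; the bounds
    on [s] take care of the clipping. *)
Lemma phases_depth u n s gamma : 0 < u -> 2 * (n%:R * u) = 1 -> 0 < gamma ->
  gamma <= u / 2 -> gamma <= s <= 1 - gamma ->
  exists2 w, w \in phase u 0 n ++ phase u u n & gamma <= depth w s.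
Proof.
move=> u0 nu g0 gu sg; pose m := Num.truncn (s / (2 * u)).
have d0 : 0 < 2 * u by lra.
have /andP[ml mh] : m%:R <= s / (2 * u) < m.+1%:R.
  by apply: truncn_itv; rewrite divr_ge0; lra.
move: ml mh; rewrite ler_pdivlMr// ltr_pdivrMr// -natr1 => ml mh.
have mn : (m < n)%N.
  rewrite ltnNge; apply/negP => nm.
  have : n%:R * u <= m%:R * u by rewrite ler_pM2r// ler_nat.
  lra.
have [h1|h1] := leP s (2 * (m%:R * u) + u / 2).
  have [||||w wP wd] := @phase_depth u u n m s gamma (ltnW mn); try lra.
  by exists w => //; rewrite mem_cat wP orbT.
have [h2|h2] := leP s (2 * (m%:R * u) + 3 / 2 * u).
  have [||||w wP wd] := @phase_depth u 0 n m s gamma (ltnW mn); try lra.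
  by exists w => //; rewrite mem_cat wP.
have [||||w wP wd] := @phase_depth u u n m.+1 s gamma mn; rewrite -?natr1; try lra.
by exists w => //; rewrite mem_cat wP orbT.
Qed.

(** The upper bound on t - s is needed as [0, 1] itself cannot grow, the lower bound
    as the gain is bounded below by a constant. *)
Definition expanding (gamma : R) (h : Clambda R) := forall s t, 0 <= s -> t <= 1 ->
  2 * gamma <= t - s -> t - s <= 1 - 2 * gamma ->
  spread (real_ext h) s t (t - s + gamma).

(** Compose the zigzags of phase 0, then those of phase u. An interval that is
    neither too short nor too long has one of its ends deep in a window. *)
Lemma expander e : 0 < e -> exists h : Clambda R, exists2 gamma0, 0 < gamma0 &
  (forall r, 0 <= r <= 1 -> `|real_ext h r - r| <= e) /\
  forall gamma, 0 < gamma -> gamma <= gamma0 -> expanding gamma h.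
Proof.
move=> e0; pose n := (Num.truncn (2 / e)).+1.
have n0 : 0 < n%:R :> R by rewrite ltr0n.
pose u := (2 * n%:R)^-1 : R.
have u0 : 0 < u by rewrite invr_gt0; lra.
have nu : 2 * (n%:R * u) = 1 by rewrite mulrA mulfV// gt_eqF//; lra.
(* Each of the two phases moves points by at most 2u. *)
have ue : 4 * u <= e.
  have : 2 / e < n%:R.
    have /truncn_itv/andP[] // : 0 <= 2 / e by rewrite divr_ge0// ltW.
  rewrite ltr_pdivrMr// => ne.
  have : 2 * (2 * u) <= (n%:R * e) * (2 * u) by rewrite ler_wpM2r; lra.
  rewrite (_ : n%:R * e * (2 * u) = e * (2 * (n%:R * u)));
    last by rewrite [RHS]mulrCA !mulrA; lra.
  by rewrite nu; lra.
have hws w : w \in phase u 0 n ++ phase u u n -> window w.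
  by rewrite mem_cat => /orP[]; apply: phase_windowP => //; exact: ltW.
have [h hE] := Clambda_zigs hws.
exists h, (u / 2); first lra.
split=> [r r01|gamma g0 gu s t s0 t1 gs gt].
  rewrite hE// /zigs foldl_cat -/(zigs _ r) -/(zigs _ (zigs _ r)).
  have c1 := phase_close u0 nu (lexx 0) (ltW u0) r01.
  have [z zE] := @Clambda_zigs (phase u 0 n) (fun w => phase_windowP u0 nu (lexx 0) (ltW u0)).
  have r01' : 0 <= zigs (phase u 0 n) r <= 1 by rewrite -zE//; exact: real_ext01.
  have c2 := phase_close u0 nu (ltW u0) (lexx u) r01'.
  move: c1 c2; rewrite !ler_norml; lra.
have : spread (zigs (phase u 0 n ++ phase u u n)) s t (t - s + gamma).
  apply: zigs_spread => //; try lra.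
  have [sg|sg] := leP gamma s.
    have [|w wP wd] := @phases_depth u n s gamma u0 nu g0 gu; first lra.
    by exists w => //; left.
  have [|w wP wd] := @phases_depth u n t gamma u0 nu g0 gu; first lra.
  by exists w => //; right.
by move=> [x [y [hx hy xy]]]; exists x, y; split=> //; rewrite !hE//; lra.
Qed.

End perturb.

(** * Density *)

Section density.
Context {R : realType}.
Implicit Types (r s t x y c d : R) (f g : Clambda R) (F : R -> R).

(** Only [h] has to stretch, as [f] and [e] do not shrink intervals. *)
Lemma spread_step f h (e : Clambda R) gamma s t : 0 < gamma -> expanding gamma h ->
  0 <= s -> t <= 1 -> 2 * gamma <= t - s ->
  spread (real_ext (Clambda_comp e (Clambda_comp h f))) s t (Num.min (1 - 2 * gamma)
    (t - s + gamma)).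
Proof.
move=> g0 hh s0 t1 gs.
have st : s <= t by lra.
have [x [y [hx hy xy]]] := nonshrinking f s0 st t1.
have [p0 _] := andP (real_ext01 f x); have [_ q1] := andP (real_ext01 f y).
have pq : real_ext f x <= real_ext f y by lra.
have [u [v [hu hv uv]]] : spread (real_ext h) (real_ext f x) (real_ext f y)
  (Num.min (1 - 2 * gamma) (t - s + gamma)).
  have [le1|gt1] := leP (real_ext f y - real_ext f x) (1 - 2 * gamma).
    apply: spread_le (hh _ _ p0 q1 _ le1); last lra.
    by rewrite ge_min; apply/orP; right; lra.
  by apply: spread_le (nonshrinking h p0 pq q1); rewrite ge_min; apply/orP; left; lra.
have m0 : 0 <= Num.min (1 - 2 * gamma) (t - s + gamma) by rewrite le_min; lra.
have [u0 _] := andP (real_ext01 h u); have [_ v1] := andP (real_ext01 h v).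
have huv : real_ext h u <= real_ext h v by lra.
have := spread_comp (@continuous_real_ext R h) hu hv (lexx _) (lexx _)
  (spread_le uv (nonshrinking e u0 huv v1)).
move=> /(spread_comp (@continuous_real_ext R f) hx hy (lexx _) (lexx _)).
by rewrite (_ : _ \o _ = real_ext (Clambda_comp e (Clambda_comp h f)))//;
  apply/funext => r; rewrite !real_ext_comp.
Qed.

Lemma spread_iter f h (e : Clambda R) gamma l N s t : 0 < gamma -> expanding gamma h ->
  0 <= s -> t <= 1 -> 2 * gamma <= l -> l <= t - s -> l <= 1 - 2 * gamma ->
  spread (real_ext (Clambda_iter N (Clambda_comp e (Clambda_comp h f)))) s t
    (Num.min (1 - 2 * gamma) (l + N%:R * gamma)).
Proof.
move=> g0 hh s0 t1 gl ls l1; set g := Clambda_comp e _.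
elim: N => [|N [x [y [hx hy xy]]]].
  exists s, t; split; try lra.
  by rewrite /real_ext /= !to_unitK; [rewrite mul0r addr0 ge_min ls orbT|lra..].
have [p0 _] := andP (real_ext01 (Clambda_iter N g) x);
  have [_ q1] := andP (real_ext01 (Clambda_iter N g) y).
have lq : l <= Num.min (1 - 2 * gamma) (l + N%:R * gamma).
  by rewrite le_min l1 /= lerDl mulr_ge0// ltW.
have gq : 2 * gamma <= iter_ext N g y - iter_ext N g x by lra.
have := spread_comp (@continuous_real_ext R (Clambda_iter N g)) hx hy (lexx _) (lexx _)
  (spread_step f e g0 hh p0 q1 gq).
rewrite (_ : _ \o _ = iter_ext N.+1 g); last by apply/funext => r; rewrite real_ext_iterS.
apply: spread_le; rewrite le_min ge_min lexx /= -natr1.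
move: xy; rewrite ge_min => /orP[le|le]; rewrite ge_min; apply/orP; [left|right]; lra.
Qed.

Lemma expanding_spreading f h (e : Clambda R) gamma0 : 0 < gamma0 ->
  (forall gamma, 0 < gamma -> gamma <= gamma0 -> expanding gamma h) ->
  forall k, spreading k (Clambda_comp e (Clambda_comp h f)).
Proof.
move=> g0 hh k; pose D : R := k.+1%:R^-1.
have D0 : 0 < D by rewrite invr_gt0.
have D1 : D <= 1 by rewrite invf_le1// ler1n.
(* With 4 gamma <= D, the final length 1 - 2 gamma exceeds 1 - D, and the
   initial length D / 2 is at least 2 gamma. *)
have [gamma [ga0 gaD gag0]] : exists gamma, [/\ 0 < gamma, 4 * gamma <= D & gamma <= gamma0].
  exists (Num.min gamma0 (D / 4)); split; first by rewrite lt_min g0; lra.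
    have : Num.min gamma0 (D / 4) <= D / 4 by rewrite ge_min lexx orbT.
    lra.
  by rewrite ge_min lexx.
pose N := (Num.truncn gamma^-1).+1.
have NP : 1 <= N%:R * gamma.
  have i0 : 0 <= gamma^-1 by rewrite invr_ge0 ltW.
  by rewrite -ler_pdivrMr// mul1r; have /andP[_ /ltW] := truncn_itv i0.
exists N => i.
have ik : i%:R / k.+1%:R = i%:R * D :> R by [].
have ik1 : i.+1%:R / k.+1%:R = i%:R * D + D :> R by rewrite -natr1 mulrDl mul1r.
have i0 : 0 <= i%:R * D by rewrite mulr_ge0// ltW.
have i1 : i%:R * D + D <= 1.
  by rewrite -ik1 ler_pdivrMr// mul1r ler_nat.
have [|||x [y [hx hy xy]]] := @spread_iter f h e gamma (D / 2) N _ _ ga0 (hh _ ga0 gag0) i0 i1.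
- lra.
- lra.
- lra.
exists x, y; rewrite ik ik1 -/D; split=> //; apply: lt_le_trans xy.
by rewrite lt_min; lra.
Qed.

(** The factor [h] of [expander] makes the composition spread intervals; the folding
    parameter d of the outer factor only has to avoid the four values for which 0 or 1
    would be sent to an end. *)
Lemma generic_approx f e : 0 < e -> exists g,
  [/\ rho f g < e, escaping g & forall k, spreading k g].
Proof.
move=> e0; have [|h [gamma0 g00 [hclose hexp]]] := @expander R (e / 4); first lra.
pose p r := real_ext h (real_ext f r).
(* The values of d for which d / 2 or 1 - d / 2 is the image of 0 or 1
   under h o f. *)
pose vs := [:: 2 * p 0; 2 * p 1; 2 - 2 * p 0; 2 - 2 * p 1].
have [|d d0 dP] := @exists_avoiding R vs (Num.min (e / 8) (1 / 2)).
  by rewrite lt_min; lra.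
have [de d2] : d < e / 8 /\ d < 1 / 2 by apply/andP; rewrite -lt_min; lra.
have [||E EP] := @folded_ends R d; [lra|lra|].
exists (Clambda_comp E (Clambda_comp h f)); split.
- apply: (@le_lt_trans _ _ (e / 2)); last lra.
  apply: rho_le => x; rewrite -!real_extE !real_ext_comp.
  have [h1 _] := EP _ (real_ext01 h (real_ext f (unit_val x))).
  have := hclose _ (real_ext01 f (unit_val x)).
  move: h1; rewrite !ler_norml; lra.
- have [m1 m3 m2 m4] : [/\ 2 * p 0 \in vs, 2 * p 1 \in vs, 2 - 2 * p 0 \in vs &
    2 - 2 * p 1 \in vs].
    by split; rewrite !inE eqxx ?orbT.
  split; rewrite !real_ext_comp; apply: (EP _ (real_ext01 h _)).2.
  + by apply/eqP => pd; have /eqP := dP (2 * p 0) m1; rewrite /p; lra.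
  + by apply/eqP => pd; have /eqP := dP (2 - 2 * p 0) m2; rewrite /p; lra.
  + by apply/eqP => pd; have /eqP := dP (2 * p 1) m3; rewrite /p; lra.
  + by apply/eqP => pd; have /eqP := dP (2 - 2 * p 1) m4; rewrite /p; lra.
- exact: expanding_spreading g00 hexp.
Qed.

End density.

Theorem corollary10 (R : realType) :
  exists G : set (Clambda R),
    [/\ Gdelta G, dense G &
        forall f : Clambda R, G f -> periodic_specification_property f].
Proof.
exists (\bigcap_k (escaping `&` spreading k)); split.
- exists (fun k => escaping `&` spreading k) => // k.
  exact: (openI (@open_escaping R) (@open_spreading R k)).
- move=> O [f Of] oO.
  have /nbhs_ballP[e /= e0 fe] : nbhs f O by exact: open_nbhs_nbhs.
  have [g [fg ge gs]] := generic_approx f e0.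
  exists g; split; first by apply: fe; rewrite ballEmdist.
  by move=> k _; split=> //; exact: gs.
- move=> f fG; apply: covers_specification; apply: generic_covers => [|k].
    by have [] := fG 0%N I.
  by have [] := fG k I.
Qed.
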